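(* Let $k\ge1$ be odd and let $F:\mathcal{U}\to\mathbb{C}^4$ be continuous with $F(\mathcal{U})\subseteq\Omega$. If $TF=F$ (i.e. $F$ is a stem function), then there exist $k$ (pairwise distinct) continuous functions $G:\mathcal{U}\to\mathbb{C}^4$ such that $$\sigma_k\circ G=F,\qquad TG=G.$$
   Context: Standing assumption: $\mathcal{U}\subset\mathbb{C}$ is either a simply connected (connected) open domain invariant under complex conjugation, or the union of two disjoint simply connected open domains exchanged by complex conjugation. For $G:\mathcal{U}\to\mathbb{C}^4$, $TG:\mathcal{U}\to\mathbb{C}^4$ is defined by $TG(z)=\overline{G(\overline z)}$ (componentwise conjugation). Points of $\mathbb{C}^4$ are written $z=(z_0,\underline{z})$ with $\underline{z}=(z_1,z_2,z_3)$, and $\underline{z}^2:=z_1^2+z_2^2+z_3^2\in\mathbb{C}$. For an integer $k\ge1$, $p_0^k$ and $p_1^{k-1}$ are the two-variable integer polynomials determined by $(x+\imath y)^k=p_0^k(x,y^2)+\imath\, y\,p_1^{k-1}(x,y^2)$ for $x,y\in\mathbb{R}$, and $\sigma_k:\mathbb{C}^4\to\mathbb{C}^4$ is $$\sigma_k(z_0,\underline{z})=\big(p_0^k(z_0,\underline{z}^2),\ p_1^{k-1}(z_0,\underline{z}^2)\,\underline{z}\big)$$ (the $k$-th power map of the algebra $\mathbb{C}\otimes_{\mathbb{R}}\mathbb{H}\cong\mathbb{C}^4$). Put $$\Omega=\{(z_0,\underline{z})\in\mathbb{C}^4:\ \underline{z}^2\ne0,\ z_0^2+\underline{z}^2\neq0,\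 z_0\neq0\}.$$ *)

(* Defs.v *)
From HB Require Import structures.
From mathcomp Require Import all_boot all_order all_algebra.
From mathcomp Require Import complex.
From mathcomp Require Import ring.
From mathcomp Require Import all_classical all_reals all_analysis.

Set Implicit Arguments.
Unset Strict Implicit.
Unset Printing Implicit Defensive.

Import Order.TTheory GRing.Theory Num.Theory.
Import numFieldNormedType.Exports.

Local Open Scope classical_set_scope.
Local Open Scope ring_scope.

(* The concrete type R[i] carries no topology in the library, but every
   numClosedFieldType does (the one of its modulus): naming R[i] as a
   numClosedFieldType makes that topology available. *)
Definition Cx (R : realType) : numClosedFieldType := R[i].

Definition toCx (R : realType) (x : R) : Cx R := x%:C%C.

(* Vectors (z_0, z_1, z_2, z_3), split as the scalar part z_0 and the vector
   part (z_1, z_2, z_3). *)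
Notation C4 R := 'rV[Cx R]_(1 + 3).

Definition scal (R : realType) (z : C4 R) : Cx R := z 0 0.
Definition vect (R : realType) (z : C4 R) : 'rV[Cx R]_3 := rsubmx z.
Definition sqv (R : realType) (v : 'rV[Cx R]_3) : Cx R :=
  \sum_(i < 3) v 0 i ^+ 2.

(* (x + i y)^k = p_0(x, y^2) + i y p_1(x, y^2): multiplying by x + i y sends
   (p_0, p_1) to (x p_0 - y^2 p_1, p_0 + x p_1).  In {poly {poly int}}, the
   outer indeterminate 'X stands for x and the inner one 'Y = 'X%:P for y^2.
   See pow_partsP and pow_parts_uniq below. *)
Fixpoint pow_parts (k : nat) : {poly {poly int}} * {poly {poly int}} :=
  if k is k'.+1 then
    let: (p, q) := pow_parts k' in
    ('X * p - ('X)%:P * q, p + 'X * q)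
  else (1, 0).

Definition pow_p0 (k : nat) : {poly {poly int}} := (pow_parts k).1.
Definition pow_p1 (k : nat) : {poly {poly int}} := (pow_parts k).2.

Definition eval2 (A : comNzRingType) (p : {poly {poly int}}) (x t : A) : A :=
  (map_poly (map_poly intr) p).[x%:P].[t].

Definition sigma (R : realType) (k : nat) (z : C4 R) : C4 R :=
  row_mx (eval2 (pow_p0 k) (scal z) (sqv (vect z)))%:M
         (eval2 (pow_p1 k) (scal z) (sqv (vect z)) *: vect z).

Definition Omega (R : realType) : set (C4 R) :=
  [set z | [/\ sqv (vect z) != 0,
               scal z ^+ 2 + sqv (vect z) != 0
             & scal z != 0]].

Definition Tconj (R : realType) (G : Cx R -> C4 R) : Cx R -> C4 R :=
  fun z => map_mx Num.conj (G z^*).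

Definition path_in (R : realType) (D : set (Cx R)) (g : R -> Cx R) : Prop :=
  {within `[0, 1], continuous g} /\ (forall s : R, s \in `[0, 1] -> D (g s)).

Definition path_connected (R : realType) (D : set (Cx R)) : Prop :=
  forall x y, D x -> D y -> exists2 g, path_in D g & g 0 = x /\ g 1 = y.

Definition null_homotopic_in (R : realType) (D : set (Cx R)) (g : R -> Cx R) :
    Prop :=
  exists H : R * R -> Cx R,
    [/\ {within `[0, 1] `*` `[0, 1], continuous H},
        (forall s t : R, s \in `[0, 1] -> t \in `[0, 1] -> D (H (s, t))),
        (forall s : R, s \in `[0, 1] -> H (s, 0) = g s /\ H (s, 1) = g 0)
      & (forall t : R, t \in `[0, 1] -> H (0, t) = g 0 /\ H (1, t) = g 0)].

Definition simply_connected (R : realType) (D : set (Cx R)) : Prop :=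
  path_connected D /\
  forall g, path_in D g -> g 0 = g 1 -> null_homotopic_in D g.

Definition sc_domain (R : realType) (D : set (Cx R)) : Prop :=
  [/\ D !=set0, open D, connected D & simply_connected D].

Definition admissible (R : realType) (U : set (Cx R)) : Prop :=
  (sc_domain U /\ Num.conj @` U = U) \/
  exists D1 D2 : set (Cx R),
    [/\ sc_domain D1, sc_domain D2, D1 `&` D2 = set0,
        Num.conj @` D1 = D2 & U = D1 `|` D2].

Lemma eval2_recl (A : comNzRingType) (p q : {poly {poly int}}) (x t : A) :
  eval2 ('X * p - ('X)%:P * q) x t = x * eval2 p x t - t * eval2 q x t.
Proof.
by rewrite /eval2 rmorphB !rmorphM /= map_polyX map_polyC /= map_polyX !hornerE.
Qed.

Lemma eval2_recr (A : comNzRingType) (p q : {poly {poly int}}) (x t : A) :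
  eval2 (p + 'X * q) x t = eval2 p x t + x * eval2 q x t.
Proof. by rewrite /eval2 rmorphD rmorphM /= map_polyX !hornerE. Qed.

Lemma pow_partsE (A : comNzRingType) (k : nat) (j x y : A) : j ^+ 2 = -1 ->
  (x + j * y) ^+ k =
    eval2 (pow_p0 k) x (y ^+ 2) + j * y * eval2 (pow_p1 k) x (y ^+ 2).
Proof.
move=> j2; rewrite /pow_p0 /pow_p1; elim: k => [|k IH] /=.
  by rewrite /eval2 rmorph1 rmorph0 !hornerE; ring.
case: (pow_parts k) IH => p q /= IH.
rewrite exprS IH eval2_recl eval2_recr.
have -> : - (y ^+ 2 * eval2 q x (y ^+ 2)) = j ^+ 2 * y ^+ 2 * eval2 q x (y ^+ 2).
  by rewrite j2; ring.
by ring.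
Qed.

Lemma toCx_eval2 (R : realType) (p : {poly {poly int}}) (x t : R) :
  toCx (eval2 p x t) = eval2 p (toCx x) (toCx t).
Proof.
rewrite /toCx /eval2 -horner_map -horner_map /= map_polyC /= -!map_poly_comp.
congr (_.[_].[_]); apply: eq_map_poly => u /=; rewrite -map_poly_comp.
by apply: eq_map_poly => n /=; rewrite rmorph_int.
Qed.

Lemma pow_partsP (R : realType) (k : nat) (x y : R) :
  (toCx x + 'i * toCx y) ^+ k =
    toCx (eval2 (pow_p0 k) x (y ^+ 2)) +
    'i * toCx y * toCx (eval2 (pow_p1 k) x (y ^+ 2)).
Proof.
rewrite (pow_partsE _ _ _ (@sqrCi (Cx R))) !toCx_eval2.
by rewrite /toCx rmorphXn.
Qed.

Lemma eval2_eq0 (R : realType) (p : {poly {poly int}}) :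
  (forall x t : R, 0 < t -> eval2 p x t = 0) -> p = 0.
Proof.
have pos_poly0 (q : {poly R}) : (forall x, 0 < x -> q.[x] = 0) -> q = 0.
  move=> q0; apply/eqP; apply: contraT => qn0.
  pose s : seq R := [seq i.+1%:R | i <- iota 0 (size q)].
  have : (size s < size q)%N.
    apply: max_poly_roots => //.
      by apply/allP => _ /mapP[i _ ->]; rewrite /root q0.
    by rewrite map_inj_uniq ?iota_uniq // => i j /eqP; rewrite eqr_nat => /eqP[].
  by rewrite size_map size_iota ltnn.
move=> p0; apply/polyP => i; rewrite coef0.
suff: map_poly intr p`_i = 0 :> {poly R}.
  move=> /polyP pi0; apply/polyP => j; have := pi0 j.
  by rewrite coef_map !coef0 => /eqP; rewrite intr_eq0 => /eqP.
apply: (pos_poly0 _) => t t0.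
have : map_poly (horner_eval t) (map_poly (map_poly intr) p) = 0.
  apply: (pos_poly0 _) => x _; rewrite -[RHS](p0 x t t0) /eval2.
  by rewrite -[x in LHS](hornerC x t) -[(_%:P).[t]]/(horner_eval t x%:P) horner_map.
by move=> /polyP/(_ i); rewrite !coef_map coef0.
Qed.

Lemma pow_parts_uniq (R : realType) (k : nat) (P Q : {poly {poly int}}) :
  (forall x y : R, (toCx x + 'i * toCx y) ^+ k =
    toCx (eval2 P x (y ^+ 2)) + 'i * toCx y * toCx (eval2 Q x (y ^+ 2))) ->
  P = pow_p0 k /\ Q = pow_p1 k.
Proof.
move=> PQ.
have key x t : 0 < t -> eval2 P x t = eval2 (pow_p0 k) x t /\
                        eval2 Q x t = eval2 (pow_p1 k) x t :> R.
  move=> t0; have := PQ x (Num.sqrt t); rewrite pow_partsP sqr_sqrtr ?ltW//.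
  have iE : 'i = 'i%C :> Cx R by [].
  set y := Num.sqrt t.
  have y0 : y != 0 by rewrite gt_eqF// sqrtr_gt0.
  move=> E; have := congr1 (@complex.Re R) E; have := congr1 (@complex.Im R) E.
  rewrite iE /toCx /=; rewrite !(mul0r, mulr0, mul1r, add0r, addr0, subr0, oppr0).
  by move=> /(mulfI y0) Eq Ep; split; rewrite ?Eq ?Ep.
have eB p q x t : eval2 (p - q) x t = eval2 p x t - eval2 q x t :> R.
  by rewrite /eval2 rmorphB !hornerE.
by split; apply/eqP; rewrite -subr_eq0; apply/eqP; apply: (@eval2_eq0 R) => x t t0;
  have [EP EQ] := key x t t0; rewrite eB ?EP ?EQ subrr.
Qed.

(* Main.v *)
Require Import Defs.
From HB Require Import structures.
From mathcomp Require Import all_boot all_order all_algebra.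
From mathcomp Require Import complex ring lra.
From mathcomp Require Import all_classical all_reals all_analysis.
Import Order.TTheory GRing.Theory Num.Theory.
Import numFieldNormedType.Exports.
Local Open Scope classical_set_scope.
Local Open Scope ring_scope.

(** Write [s] for the square of the vector part of [F] and choose a continuous
    square root [w] of [s].  The elements [F_0 + i w] and [F_0 - i w] are the two
    coordinates of [F] in the commutative subalgebra generated by [vect F], which
    splits as a product of two copies of the complex numbers, and [sigma k] acts
    on them as [x |-> x ^+ k].  Hence, from continuous [k]-th roots [p] and [q] of
    the two coordinates, the function with scalar part [(p + q) / 2] and vector part
    [(p - q) / (2 i w)] times [vect F] satisfies [sigma k G = F] ([sigma_root]).
    On Omega, [s] does not vanish, and neither do the coordinates, whose product
    is [F_0 ^+ 2 + s]; so continuous roots exist on simply connected domains.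

    The symmetry comes from the choice of the roots.  If [w] commutes with
    conjugation, then conjugation exchanges the two coordinates, so that
    [q z := (p z^* )^*] is a [k]-th root of the second one, and the resulting [G]
    is a stem function.  Such a [w] exists ([stem_sqrt]): on two conjugate
    domains a root on the first is reflected to the second; a domain equal to its
    conjugate contains a real point, where the vector part of [F] is real, hence
    [s > 0] and [w] is real, and the quotient of [w] by its reflection, being a
    continuous sign, is [1] everywhere.  Multiplying [p] by the [k] roots of unity
    gives [k] functions, which differ because [G] and [w] determine [p]
    ([root_of_sigma]).

    Continuous [n]-th roots of a nonvanishing [f] on a simply connected [D]
    ([root_on_simply_connected]) are obtained as follows.  On a square, uniform
    continuity makes [f (x (j + 1) / N) / f (x j / N)] close to [1], and the product
    of the principal roots of these ratios telescopes to a root of [f x / f 0].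
    On [D], roots are transported along paths from a base point; the root of [f]
    over the square of a null homotopy shows that the result depends only on
    the endpoint. *)

Set Implicit Arguments.
Unset Strict Implicit.
Unset Printing Implicit Defensive.

(** * The complex plane and the principal root *)

Lemma cvg_Cx (R : realType) (T : Type) (F : set_system T) (FF : Filter F)
    (f : T -> Cx R) (l : Cx R) :
  (forall e : R, 0 < e -> \forall x \near F, `|f x - l| < toCx e) -> f @ F --> l.
Proof.
move=> H; apply/cvgrPdist_lt => e e0.
have [e1 ee] : exists e1 : R, e = toCx e1.
  case: e e0 => a b; rewrite ltcE /= => /andP[/eqP -> _]; by exists a.
rewrite ee; have : 0 < e1 by move: e0; rewrite ee ltcR.
move=> /H; apply: filterS => x; by rewrite distrC.
Qed.

Lemma continuous_toCx (R : realType) : continuous (@toCx R).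
Proof.
move=> x; apply: cvg_Cx => e e0.
near=> y.
rewrite /toCx -rmorphB /= normc_def /= expr0n /= addr0 sqrtr_sqr ltcR.
near: y.
have := nbhsx_ballx x _ e0; apply: filterS => y.
by rewrite -ball_normE /= distrC.
Unshelve. all: by end_near. Qed.

Lemma toCxM (R : realType) (x y : R) : toCx (x * y) = toCx x * toCx y.
Proof. exact: rmorphM. Qed.

Lemma toCxX (R : realType) (x : R) n : toCx (x ^+ n) = toCx x ^+ n.
Proof. exact: rmorphXn. Qed.

Lemma near_dist_Cx (R : realType) (z e : Cx R) : 0 < e ->
  \forall y \near z, `|z - y| < e.
Proof.
by move=> e0; have := nbhsx_ballx z _ e0; apply: filterS => y; rewrite -ball_normE.
Qed.

Lemma continuous_Re (R : realType) : continuous (@complex.Re R : Cx R -> R).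
Proof.
move=> z; apply/(@cvgrPdist_lt _ _ _ (nbhs (z : Cx R))) => e e0.
have e0' : 0 < toCx e by rewrite ltcR.
have := near_dist_Cx z e0'; apply: filterS => y /= h.
rewrite -ltcR; apply: le_lt_trans h.
by have := normc_ge_Re (z - y); case: z y => [? ?] [? ?] /=.
Qed.

Lemma continuous_Im (R : realType) : continuous (@complex.Im R : Cx R -> R).
Proof.
move=> z; apply/(@cvgrPdist_lt _ _ _ (nbhs (z : Cx R))) => e e0.
have e0' : 0 < toCx e by rewrite ltcR.
have := near_dist_Cx z e0'; apply: filterS => y /= h.
rewrite -ltcR; apply: le_lt_trans h.
have := normc_ge_Re ('i%C * (z - y)); rewrite normrM.
case: z y => [? ?] [? ?] /=; rewrite mul0r mul1r sub0r normrN => /le_trans; apply.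
by rewrite normc_def/= !expr0n expr1n /= add0r sqrtr1 mul1r.
Qed.

Lemma continuous_conj (R : realType) : continuous (Num.conj : Cx R -> Cx R).
Proof.
move=> z; apply/(@cvgrPdist_lt _ _ _ (nbhs (z : Cx R))) => e e0.
have := near_dist_Cx z e0.
by apply: filterS => y; rewrite -rmorphB norm_conjC.
Qed.

(** The branch of the [n]-th root on the half-plane of positive real part.  There
    the modulus of [z] is [Re z / cos (arg z)], which is what the exponential
    factor encodes. *)
Definition principal_root (R : realType) (n : nat) (z : Cx R) : Cx R :=
  let th := atan (complex.Im z / complex.Re z) in
  toCx (expR ((ln (complex.Re z) - ln (cos th)) / n%:R)) *
   (toCx (cos (th / n%:R)) + 'i * toCx (sin (th / n%:R))).

Lemma de_moivre (R : realType) (x : R) (n : nat) :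
  (toCx (cos x) + 'i * toCx (sin x)) ^+ n =
  toCx (cos (x *+ n)) + 'i * toCx (sin (x *+ n)).
Proof.
elim: n => [|n IH].
  by rewrite expr0 mulr0n cos0 sin0 /toCx rmorph0 rmorph1 mulr0 addr0.
rewrite exprS IH mulrS cosD sinD /toCx rmorphB rmorphD !rmorphM /=.
have i2 := @sqrCi (Cx R).
rewrite mulrDl !mulrDr -!addrA; congr (_ + _).
set a := (cos x)%:C%C; set b := (sin x)%:C%C.
set c := (cos _)%:C%C; set d := (sin _)%:C%C.
have -> : - (b * d) = 'i ^+ 2 * b * d by rewrite i2; ring.
ring.
Qed.

Lemma principal_root1 (R : realType) n : principal_root n (1 : Cx R) = 1.
Proof.
rewrite /principal_root /= mul0r atan0 cos0 ln1 subrr !mul0r cos0 sin0 expR0.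
by rewrite /toCx rmorph0 rmorph1 mulr0 addr0 mulr1.
Qed.

Lemma principal_rootX (R : realType) n (z : Cx R) :
  (0 < n)%N -> 0 < complex.Re z -> principal_root n z ^+ n = z.
Proof.
move=> n0 z0; rewrite /principal_root; set th := atan _.
have nn : n%:R != 0 :> R by rewrite pnatr_eq0 -lt0n.
have cth : 0 < cos th.
  by apply: cos_gt0_pihalf; rewrite atan_gtNpi2 atan_ltpi2.
have tth : tan th = complex.Im z / complex.Re z by rewrite atanK.
have thn : (th / n%:R) *+ n = th by rewrite -mulr_natr divfK.
set l := ln _ - _.
have ln_n : expR (l / n%:R) ^+ n = complex.Re z / cos th.
  by rewrite -expRM_natr divfK// /l expRD expRN !lnK ?posrE.
have sth : complex.Re z / cos th * sin th = complex.Im z.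
  by rewrite -mulrA [_^-1 * _]mulrC -/(tan th) tth mulrC divfK ?gt_eqF.
have cc : complex.Re z / cos th * cos th = complex.Re z by rewrite divfK ?gt_eqF.
rewrite exprMn de_moivre thn -toCxX ln_n mulrDr mulrCA -!toCxM cc sth.
exact: esym (complexE z).
Qed.

Lemma continuous_principal_root (R : realType) n (z : Cx R) :
  0 < complex.Re z -> {for z, continuous (@principal_root R n)}.
Proof.
move=> z0; rewrite /principal_root.
pose th (z : Cx R) := atan (complex.Im z / complex.Re z).
have cth : {for z, continuous th}.
  apply: continuous_comp; last exact: continuous_atan.
  have cV : {for z, continuous (fun z : Cx R => (complex.Re z)^-1)}.
    by apply: continuousV; [rewrite gt_eqF|exact: continuous_Re].
  by apply: (continuousM _ cV); exact: continuous_Im.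
have cthn : {for z, continuous (fun z : Cx R => th z / n%:R)}.
  by apply: (continuousM cth); exact: cst_continuous.
have clnRe : {for z, continuous (fun z : Cx R => ln (complex.Re z))}.
  by apply: continuous_comp; [exact: continuous_Re|exact: continuous_ln].
have clncos : {for z, continuous (fun z : Cx R => ln (cos (th z)))}.
  apply: (@continuous_comp _ _ _ (fun z : Cx R => cos (th z))).
    by apply: continuous_comp => //; exact: continuous_cos.
  by apply: continuous_ln; apply: cos_gt0_pihalf; rewrite atan_gtNpi2 atan_ltpi2.
apply: continuousM; [|apply: continuousD; [|apply: continuousM]].
- pose l (z : Cx R) := ln (complex.Re z) - ln (cos (th z)).
  have cl : {for z, continuous l} by exact: (continuousB clnRe clncos).
  have cln : {for z, continuous (fun z => l z / n%:R)}.
    by apply: (continuousM cl); exact: cst_continuous.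
  apply: (@continuous_comp _ _ _ (fun z => expR (l z / n%:R)));
    last exact: continuous_toCx.
  by apply: continuous_comp; [exact: cln|exact: continuous_expR].
- apply: (@continuous_comp _ _ _ (fun z : Cx R => cos (th z / n%:R)));
    last exact: continuous_toCx.
  by apply: continuous_comp => //; exact: continuous_cos.
- exact: cst_continuous.
apply: (@continuous_comp _ _ _ (fun z : Cx R => sin (th z / n%:R)));
  last exact: continuous_toCx.
by apply: continuous_comp => //; exact: continuous_sin.
Qed.

(** The disc of radius [1] around [1] is the neighbourhood on which the principal
    root gets used: a ratio of nearby values of a nonvanishing function falls in
    it. *)
Lemma Re_gt0_near1 (R : realType) (z : Cx R) : `|z - 1| < 1 -> 0 < complex.Re z.
Proof.
move=> h; have := le_lt_trans (normc_ge_Re (z - 1)) h.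
by rewrite ltcR; case: z {h} => a b /=; rewrite ltr_norml => /andP[]; lra.
Qed.

(** * Continuity of maps, globally and on a domain *)

Lemma continuous_mul (K : numFieldType) (T : topologicalType) (u v : T -> K) :
  continuous u -> continuous v -> continuous (fun x => u x * v x).
Proof. by move=> cu cv x; exact: (continuousM (cu x) (cv x)). Qed.

Lemma continuous_add (K : numFieldType) (T : topologicalType) (u v : T -> K) :
  continuous u -> continuous v -> continuous (fun x => u x + v x).
Proof. by move=> cu cv x; exact: (continuousD (cu x) (cv x)). Qed.

Lemma continuous_inv (K : numFieldType) (T : topologicalType) (u : T -> K) :
  (forall x, u x != 0) -> continuous u -> continuous (fun x => (u x)^-1).
Proof. by move=> u0 cu x; exact: (continuousV (u0 x) (cu x)). Qed.

Lemma continuous_const (T V : topologicalType) (c : V) : continuous (fun _ : T => c).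
Proof. by move=> x; exact: cvg_cst. Qed.

Lemma continuous_compose (T V W : topologicalType) (u : T -> V) (v : V -> W) :
  continuous u -> continuous v -> continuous (fun x => v (u x)).
Proof. by move=> cu cv x; exact: (continuous_comp (cu x) (cv (u x))). Qed.

Lemma continuous_pair (T V W : topologicalType) (f : T -> V) (g : T -> W) :
  continuous f -> continuous g -> continuous (fun x => (f x, g x)).
Proof.
by move=> cf cg x; apply: (@cvg_pair _ _ _ (nbhs x) (nbhs (f x)) (nbhs (g x)));
  [exact: cf|exact: cg].
Qed.

(** This turns continuity within a subset, such as the unit interval or square,
    into global continuity after precomposition with a retraction onto it. *)
Lemma continuous_within_comp (T V W : topologicalType) (A : set V) (c : T -> V)
    (f : V -> W) :
  continuous c -> (forall t, A (c t)) -> {within A, continuous f} ->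
  continuous (f \o c).
Proof.
move=> cc Ac /subspace_continuousP cf t B /(cf _ (Ac t)) fB.
have : nbhs (c t) [set y | A y -> B (f y)] by exact: fB.
by move=> /(cc t); apply: (@filterS _ (nbhs t)) => x; apply; exact: Ac.
Qed.

Section ContinuousOn.
Context {R : realType}.

(** On an open set this is continuity within the set; the pointwise form is the
    one that composes without reference to subspace topologies. *)
Definition continuous_on (V : topologicalType) (D : set (Cx R)) (u : Cx R -> V) :=
  forall x, D x -> {for x, continuous u}.

Lemma continuous_onP (V : topologicalType) (D : set (Cx R)) (u : Cx R -> V) :
  open D -> {within D, continuous u} <-> continuous_on D u.
Proof.
move=> oD; rewrite continuous_open_subspace//; split => h x.
  by move=> Dx; apply: h; rewrite inE.
by rewrite inE; exact: h.
Qed.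

Lemma eq_continuous_on (V : topologicalType) (D : set (Cx R)) (u v : Cx R -> V) :
  open D -> (forall x, D x -> u x = v x) -> continuous_on D v -> continuous_on D u.
Proof.
move=> oD uv cv x Dx B; rewrite uv// => hB.
have vB : nbhs x (v @^-1` B) by exact: (cv x Dx _ hB).
suff: nbhs x (u @^-1` B) by [].
have nD : \forall y \near x, D y by exact: open_nbhs_nbhs.
apply: (@filterS _ (nbhs x) _ _ _ _ (@filterI _ (nbhs x) _ _ _ vB nD)).
by move=> y [/= vy Dy]; rewrite uv.
Qed.

Lemma continuous_on_entry m n (D : set (Cx R)) (u : Cx R -> 'M[Cx R]_(m, n)) i j :
  continuous_on D u -> continuous_on D (fun z => u z i j).
Proof.
move=> cu x Dx; apply: (@continuous_comp _ _ _ u (fun M : 'M[Cx R]_(m, n) => M i j)).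
  exact: cu.
exact: coord_continuous.
Qed.

Lemma continuous_on_mx m n (D : set (Cx R)) (u : Cx R -> 'M[Cx R]_(m, n)) :
  (forall i j, continuous_on D (fun z => u z i j)) -> continuous_on D u.
Proof.
move=> cu x Dx B [P nP PB].
suff: nbhs x (u @^-1` B) by [].
apply: (@filterS _ (nbhs x) _ [set y | forall i j, P i j (u y i j)]).
  by move=> y Py; exact: PB.
apply: (@filter_forall _ _ (fun i y => forall j, P i j (u y i j)) (nbhs x)) => i.
apply: (@filter_forall _ _ (fun j y => P i j (u y i j)) (nbhs x)) => j.
exact: (cu i j x Dx _ (nP i j)).
Qed.

Lemma continuous_onM D (u v : Cx R -> Cx R) :
  continuous_on D u -> continuous_on D v -> continuous_on D (fun z => u z * v z).
Proof. by move=> cu cv x Dx; exact: (continuousM (cu x Dx) (cv x Dx)). Qed.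

Lemma continuous_onD D (u v : Cx R -> Cx R) :
  continuous_on D u -> continuous_on D v -> continuous_on D (fun z => u z + v z).
Proof. by move=> cu cv x Dx; exact: (continuousD (cu x Dx) (cv x Dx)). Qed.

Lemma continuous_onN D (u : Cx R -> Cx R) :
  continuous_on D u -> continuous_on D (fun z => - u z).
Proof. by move=> cu x Dx; exact: (continuousN (cu x Dx)). Qed.

Lemma continuous_onV D (u : Cx R -> Cx R) : (forall z, D z -> u z != 0) ->
  continuous_on D u -> continuous_on D (fun z => (u z)^-1).
Proof. by move=> u0 cu x Dx; exact: (continuousV (u0 x Dx) (cu x Dx)). Qed.

Lemma continuous_on_cst D (c : Cx R) : continuous_on D (fun _ => c).
Proof. by move=> x Dx; exact: cst_continuous. Qed.

Lemma continuous_on_sum D (I : Type) (l : seq I) (u : I -> Cx R -> Cx R) :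
  (forall i, continuous_on D (u i)) -> continuous_on D (fun z => \sum_(i <- l) u i z).
Proof.
move=> cu; elim: l => [|i l IH].
  by under eq_fun do rewrite big_nil; exact: continuous_on_cst.
by under eq_fun do rewrite big_cons; exact: (continuous_onD (cu i) IH).
Qed.

Lemma continuous_on_conj (D : set (Cx R)) (D' : set (Cx R)) (u : Cx R -> Cx R) :
  (forall z, D' z -> D z^*) -> continuous_on D u -> continuous_on D' (fun z => (u z^*)^*).
Proof.
move=> DD cu x Dx.
have c1 : {for x, continuous (fun z => u z^*)}.
  exact: (continuous_comp (@continuous_conj R x) (cu _ (DD _ Dx))).
exact: (continuous_comp c1 (@continuous_conj R _)).
Qed.

End ContinuousOn.

(** * Roots on the unit square *)

(** The retraction of the line onto the unit interval.  Paths and homotopies are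
    precomposed with it, so that they become continuous maps on the whole line or
    plane. *)
Definition clamp (R : realType) (t : R) : R := Num.max 0 (Num.min t 1).

Lemma continuous_clamp (R : realType) : continuous (@clamp R).
Proof.
move=> t; apply: (@continuous_max R R (cst 0) (fun t => Num.min t 1)).
  exact: cst_continuous.
by apply: (@continuous_min R R id (cst 1)) => //; exact: cst_continuous.
Qed.

Lemma clamp_itv (R : realType) (t : R) : clamp t \in `[0, 1].
Proof. by rewrite in_itv /= /clamp le_max lexx ge_max ler01 ge_min lexx orbT. Qed.

Lemma clamp_id (R : realType) (t : R) : t \in `[0, 1] -> clamp t = t.
Proof.
by rewrite in_itv /= /clamp => /andP[t0 t1]; rewrite (min_idPl t1) (max_idPr t0).
Qed.

Lemma clamp0 (R : realType) (t : R) : t <= 0 -> clamp t = 0.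
Proof.
by move=> t0; rewrite /clamp (min_idPl _) ?(max_idPl _)// (le_trans t0).
Qed.

Lemma clamp1 (R : realType) (t : R) : 1 <= t -> clamp t = 1.
Proof. by move=> t1; rewrite /clamp (min_idPr _)// (max_idPr _). Qed.

Lemma continuous_prod (R : realType) (T : topologicalType) (g : nat -> T -> Cx R)
    (N : nat) :
  (forall j, (j < N)%N -> continuous (g j)) ->
  continuous (fun x => \prod_(0 <= j < N) g j x).
Proof.
elim: N => [|N IH] cg x.
  by under eq_fun do rewrite big_nil; exact: cvg_cst.
under eq_fun do rewrite big_nat_recr//=.
apply: continuousM; last exact: cg.
by apply: IH => j jN; apply: cg; exact: ltnW.
Qed.

Lemma continuous_root_ratio (R : realType) (T : topologicalType) n (u v : T -> Cx R) :
  continuous u -> continuous v -> (forall x, v x != 0) ->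
  (forall x, `|u x / v x - 1| < 1) -> continuous (fun x => principal_root n (u x / v x)).
Proof.
move=> cu cv v0 uv x.
apply: (@continuous_comp _ _ _ (fun x => u x / v x)).
  by apply: continuousM; [exact: cu|apply: continuousV => //; exact: cv].
by apply: continuous_principal_root; apply: Re_gt0_near1.
Qed.

(** Consecutive terms of the chain have ratios in the domain of the principal
    root, and the product of these ratios telescopes. *)
Lemma root_of_chain (R : realType) (T : topologicalType) n (g : nat -> T -> Cx R) N :
  (0 < n)%N -> (0 < N)%N -> (forall j, continuous (g j)) -> (forall j x, g j x != 0) ->
  (forall j x, (j < N)%N -> `|g j.+1 x / g j x - 1| < 1) ->
  exists2 h : T -> Cx R, continuous h & forall x, h x ^+ n = g N x / g 0 x.
Proof.
move=> n0 N0 cg g0 ratio.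
exists (fun x => \prod_(0 <= j < N) principal_root n (g j.+1 x / g j x)).
  apply: (@continuous_prod R T (fun j x => principal_root n (g j.+1 x / g j x))) => j jN.
  by apply: continuous_root_ratio => // x; exact: ratio.
move=> x; rewrite -prodrXl (telescope_prodf_eq (g^~ x))//.
by move=> j /andP[_ jN]; rewrite principal_rootX//; apply: Re_gt0_near1; exact: ratio.
Qed.

(** Uniform continuity of [log f] on the unit square, phrased without logarithms:
    the condition on the ratio is open at every diagonal point, and compactness
    makes the radius uniform. *)
Lemma ratio_near1_uniform (R : realType) (f : R * R -> Cx R) :
  continuous f -> (forall x, f x != 0) ->
  exists N : nat, forall x y : R * R,
    x.1 \in `[0, 1] -> x.2 \in `[0, 1] ->
    ball x (N.+1%:R^-1) y -> `|f y / f x - 1| < 1.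
Proof.
move=> cf f0.
pose K : set (R * R) := `[0, 1]%classic `*` `[0, 1]%classic.
have cK : compact K by apply: compact_setX; exact: segment_compact.
have /compact_near_coveringP/(_ nat \oo) := cK.
move=> /(_ (fun N x => forall y : R * R, ball x (N.+1%:R^-1) y -> `|f y / f x - 1| < 1)).
case=> [x0 _|N _ HN]; last first.
  by exists N => x y x1 x2; apply: (HN N) => //=; split.
have : {for (x0, x0), continuous (fun p : (R * R) * (R * R) => f p.2 / f p.1)}.
  apply: continuousM; last apply: continuousV => //.
    by apply: continuous_comp; [exact: cvg_snd|exact: cf].
  by apply: continuous_comp; [exact: cvg_fst|exact: cf].
have b1 : nbhs ((f (x0, x0).2 / f (x0, x0).1) : Cx R) [set w : Cx R | `|w - 1| < 1].
  rewrite /= divff//; have := near_dist_Cx (1 : Cx R) ltr01; apply: filterS => w /=.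
  by rewrite distrC.
move=> /(_ _ b1) [[A B] /= [/nbhs_ballP[a a0 xA] /nbhs_ballP[b b0 xB]] AB].
pose e := Num.min a b.
have e0 : 0 < e by rewrite lt_min; apply/andP.
have e20 : 0 < e / 2 by rewrite divr_gt0.
exists (ball x0 (e / 2), [set N | N.+1%:R^-1 < e / 2]).
  split; first exact: nbhsx_ballx.
  exact: (near_infty_natSinv_lt (PosNum e20)).
move=> [x N] /= [xx0 Ne] y yx; apply: (AB (x, y)) => /=; split.
  apply: xA; apply: le_ball xx0; apply: (@le_trans _ _ e); last by rewrite ge_min lexx.
  by rewrite ler_pdivrMr// ler_peMr ?ltW// ltr1n.
apply: xB; apply: (@le_ball _ _ _ e); first by rewrite ge_min lexx orbT.
by rewrite [e]splitr; apply: ball_triangle xx0 _; apply: le_ball yx; exact: ltW.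
Qed.

(** The chain runs from [f 0] to [f x] along the segment joining the origin to
    [x]: the square being star-shaped, no lifting argument is needed. *)
Lemma root_on_square (R : realType) n (f : R * R -> Cx R) : (0 < n)%N ->
  continuous f -> (forall x, f x != 0) ->
  exists2 h : R * R -> Cx R, continuous h &
    forall s t, s \in `[0, 1] -> t \in `[0, 1] -> h (s, t) ^+ n = f (s, t).
Proof.
move=> n0 cf f0; have [N HN] := ratio_near1_uniform cf f0.
pose p j (x : R * R) : R * R :=
  (j%:R / N.+2%:R * clamp x.1, j%:R / N.+2%:R * clamp x.2).
have cp j : continuous (p j).
  have cl c (u : R * R -> R) : continuous u -> continuous (fun x => c * clamp (u x)).
    move=> cu; apply: (continuous_mul (@continuous_const _ _ c)).
    exact: continuous_compose cu (@continuous_clamp R).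
  by apply: continuous_pair; apply: cl => x; [exact: cvg_fst|exact: cvg_snd].
have cfp j : continuous (fun x => f (p j x)).
  by move=> x; apply: continuous_comp; [exact: cp|exact: cf].
have pK j t : (j <= N.+2)%N -> j%:R / N.+2%:R * clamp t \in `[0, 1].
  move=> jN; have := clamp_itv t; rewrite !in_itv /= => /andP[t0 t1].
  rewrite mulr_ge0 ?divr_ge0//= mulr_ile1 ?divr_ge0//.
  by rewrite ler_pdivrMr ?ltr0n// mul1r ler_nat.
(* The division by N + 2 rather than N + 1 makes this distance strictly smaller
   than the uniform radius, even at clamp t = 1. *)
have close j t : ball (j%:R / N.+2%:R * clamp t) (N.+1%:R^-1)
    (j.+1%:R / N.+2%:R * clamp t).
  rewrite -ball_normE /= distrC -mulrBl -mulrBl -natrB// subSnn mul1r.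
  have := clamp_itv t; rewrite in_itv /= => /andP[t0 t1].
  rewrite ger0_norm ?mulr_ge0// ?invr_ge0//.
  apply: (@le_lt_trans _ _ N.+2%:R^-1).
    by rewrite ler_piMr ?invr_ge0.
  by rewrite ltf_pV2 ?posrE ?ltr0n// ltr_nat.
have ratio j x : (j < N.+2)%N -> `|f (p j.+1 x) / f (p j x) - 1| < 1.
  by move=> jN; apply: HN; [apply: pK; exact: ltnW..|split; exact: close].
have [h ch hn] := root_of_chain n0 (ltn0Sn N.+1) cfp (fun j x => f0 (p j x)) ratio.
exists (fun x => n.-root (f (0, 0)) * h x).
  by move=> x; apply: continuousM (ch x); exact: cst_continuous.
move=> s t s01 t01; rewrite exprMn rootCK// hn.
by rewrite /p divff ?pnatr_eq0// !mul1r !mul0r /= !clamp_id// mulrC divfK.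
Qed.

(** * Roots on simply connected domains *)

Lemma roots_of_unity (R : realType) n : (0 < n)%N ->
  exists s : seq (Cx R), [/\ uniq s, size s = n & forall z, (z \in s) = (z ^+ n == 1)].
Proof.
move=> n0; have [s] := closed_field_poly_normal ('X^n - 1 : {poly Cx R}).
rewrite -(prednK n0) lead_coefXnsubC// scale1r prednK// => es.
exists s; split.
- have : separable.separable_poly ('X^n - 1 : {poly Cx R}).
    by apply: cyclotomic.separable_Xn_sub_1; rewrite pnatr_eq0 -lt0n.
  by rewrite es separable.separable_prod_XsubC.
- have := congr1 (fun p : {poly Cx R} => size p) es.
  by rewrite size_prod_XsubC size_XnsubC// => -[].
- move=> z; have := congr1 (fun p => root p z) es.
  by rewrite root_prod_XsubC => <-; rewrite rootE !hornerE subr_eq0.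
Qed.

(** The [n]-th roots of unity form a finite, hence discrete, subset of the complex
    plane, so their connected subsets are singletons. *)
Lemma unity_valued_const (R : realType) (T : topologicalType) (D : set T) n
    (q : T -> Cx R) : (0 < n)%N -> connected D -> {within D, continuous q} ->
  (forall x, D x -> q x ^+ n = 1) -> forall x y, D x -> D y -> q x = q y.
Proof.
move=> n0 cD cq qn x y Dx Dy; have [s [_ _ sE]] := @roots_of_unity R n n0.
have hCx : hausdorff_space (Cx R) by exact: norm_hausdorff.
have fin_closed (l : seq (Cx R)) : closed [set` l].
  apply: (accessible_finite_set_closed.1 (hausdorff_accessible hCx)).
  exact: finite_seq.
have cB := connected_continuous_connected cD cq.
have E : [set q x] = [set q z | z in D].
  apply: cB.
  - by exists (q x).
  - exists (~` [set` [seq z <- s | z != q x]]).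
      by apply: closed_openC; exact: fin_closed.
    apply/seteqP; split => [_ ->|_ [[z Dz <-]] /= h].
      by split; [exists x|rewrite /= mem_filter eqxx].
    apply/eqP/negPn/negP => ne; apply: h.
    by rewrite mem_filter ne sE; apply/eqP; exact: qn.
  - exists [set` [:: q x]]; first exact: fin_closed.
    apply/seteqP; split => [_ ->|w [_]]; last by rewrite /= inE => /eqP.
    by split; [exists x|rewrite /= inE].
have : [set q z | z in D] (q y) by exists y.
by rewrite -E => ->.
Qed.

(** The quotient of two roots of the same function is valued in the roots of
    unity, hence constant. *)
Lemma root_unique (R : realType) n (u v : R -> Cx R) : (0 < n)%N ->
  continuous u -> continuous v -> (forall s, u s ^+ n = v s ^+ n) ->
  (forall s, v s != 0) -> u 0 = v 0 -> u =1 v.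
Proof.
move=> n0 cu cv uv v0 uv0 s.
have cq : {within [set: R], continuous (fun s => u s / v s)}.
  apply: continuous_subspaceT.
  exact: (continuous_mul cu (continuous_inv v0 cv)).
have cR : connected [set: R] by apply/connected_intervalP.
have qn t : [set: R] t -> (u t / v t) ^+ n = 1.
  by move=> _; rewrite expr_div_n uv divff// expf_neq0.
have := unity_valued_const n0 cR cq qn (I : [set: R] s) (I : [set: R] 0).
by rewrite uv0 divff// => /(congr1 ( *%R^~ (v s))); rewrite divfK// mul1r.
Qed.

(** A function on the line is viewed as a function on the plane that ignores the
    second coordinate. *)
Lemma root_on_path (R : realType) n (f : R -> Cx R) (r : Cx R) : (0 < n)%N ->
  continuous f -> (forall s, f s != 0) -> r ^+ n = f 0 ->
  exists h : R -> Cx R, [/\ continuous h, forall s, h s ^+ n = f (clamp s) & h 0 = r].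
Proof.
move=> n0 cf f0 rn.
have [h ch hn] : exists2 h : R * R -> Cx R, continuous h &
    forall s t, s \in `[0, 1] -> t \in `[0, 1] -> h (s, t) ^+ n = f s.
  by apply: (@root_on_square R n (fun x => f x.1)) => // x; apply: continuous_comp;
    [exact: cvg_fst|exact: cf].
have i0 : (0 : R) \in `[0, 1] by rewrite in_itv /= lexx ler01.
have h00 : h (0, 0) != 0.
  by apply: contra_neq (f0 0) => h0; rewrite -(hn 0 0)// h0 expr0n gtn_eqF.
exists (fun s => h (clamp s, 0) * (r / h (0, 0))); split.
- have cc : continuous (fun s : R => (clamp s, 0 : R)).
    exact: (continuous_pair (@continuous_clamp R) (@continuous_const _ _ 0)).
  exact: (continuous_mul (continuous_compose cc ch) (@continuous_const _ _ _)).
- move=> s; rewrite exprMn expr_div_n !hn//; last exact: clamp_itv.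
  by rewrite rn divff// mulr1.
- by rewrite clamp_id// mulrC divfK.
Qed.

(** The value [r] at [x] is obtained from the value [r0] at [x0] by following a
    continuous root [h] of [f] along a path [g] in [D].  Continuity is asked on the
    whole line, with no condition outside the unit interval except that [g]
    stays in [D] and [h] remains a root. *)
Definition lifts_to (R : realType) (D : set (Cx R)) (f : Cx R -> Cx R) n
    (x0 r0 x r : Cx R) : Prop :=
  exists g h : R -> Cx R,
    [/\ continuous g, (forall s, D (g s)), continuous h,
        (forall s, h s ^+ n = f (g s)) &
        [/\ g 0 = x0, h 0 = r0, g 1 = x & h 1 = r]].

Lemma clamp_halves (R : realType) (s : R) : let c := clamp s in
  [/\ 1 / 2 * c + 0 \in `[0, 1], 1 / 2 * c + 0 <= 1 / 2, 2 * (1 / 2 * c + 0) = c,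
      - (1 / 2) * c + 1 \in `[0, 1] &
      1 / 2 <= - (1 / 2) * c + 1 /\ 2 - 2 * (- (1 / 2) * c + 1) = c].
Proof.
have := clamp_itv s; rewrite in_itv /=; set c := clamp s => /andP[c0 c1].
by rewrite !in_itv /=; split; [apply/andP; split|..|apply/andP; split|split]; lra.
Qed.

Lemma half_compl (R : realType) : - (1 / 2) + 1 = 1 / 2 :> R.
Proof. by lra. Qed.

Section Lift.
Context {R : realType} {D : set (Cx R)} {f : Cx R -> Cx R} {n : nat}.
Hypotheses (n0 : (0 < n)%N) (cf : continuous_on D f)
  (f0 : forall x, D x -> f x != 0).

Lemma continuous_along (T : topologicalType) (g : T -> Cx R) :
  continuous g -> (forall s, D (g s)) -> continuous (fun s => f (g s)).
Proof. by move=> cg Dg s; apply: continuous_comp; [exact: cg|exact: cf]. Qed.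

(** Paths [a] and [b] that meet at [c] are concatenated as [a + b - c], each being
    reparametrised so as to stay at [c] while the other one moves.  Continuity at the
    junction is then automatic. *)
Lemma continuous_junction (V : topologicalType) (a b : V -> Cx R) c :
  continuous a -> continuous b -> continuous (fun s => a s + b s - c).
Proof.
move=> ca cb.
exact: (continuous_add (continuous_add ca cb) (@continuous_const _ _ (- c))).
Qed.

Lemma continuous_clamp_affine (g : R -> Cx R) (a b : R) :
  continuous g -> continuous (fun s => g (clamp (a * s + b))).
Proof.
move=> cg; apply: continuous_compose cg; apply: continuous_compose (@continuous_clamp R).
apply: (continuous_add _ (@continuous_const _ _ b)).
by apply: (continuous_mul (@continuous_const _ _ a)) => ?.
Qed.

Lemma lifts_to_ex x0 r0 x : path_connected D -> D x0 -> r0 ^+ n = f x0 -> D x ->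
  exists r, lifts_to D f n x0 r0 x r.
Proof.
move=> pD Dx0 r0n Dx; have [g [cg Dg] [g0 g1]] := pD _ _ Dx0 Dx.
have cG : continuous (g \o @clamp R).
  apply: continuous_within_comp cg; first exact: continuous_clamp.
  by move=> t; exact: clamp_itv.
have DG s : D (g (clamp s)) by apply: Dg; exact: clamp_itv.
have G0 : g (clamp 0) = x0 by rewrite clamp0.
have [|h [ch hn h0]] :=
    @root_on_path R n _ r0 n0 (continuous_along cG DG) (fun s => f0 (DG s)).
  by rewrite /= G0.
exists (h 1), (g \o @clamp R), h; split => //.
  by move=> s; rewrite hn /= (clamp_id (clamp_itv s)).
by split => //=; rewrite clamp1.
Qed.

(** Monodromy: following one path and coming back along the other is a loop,
    contracted by some [H] on the unit square.  A root of [f] over [H] is constant on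
    the three sides that [H] sends to the base point, so over the loop it starts
    and ends at [r0].  By uniqueness along paths it agrees with the two given
    roots on the two halves of the loop, and its value at the middle is both [r]
    and [r']. *)
Lemma lifts_to_uniq x0 r0 x r r' : simply_connected D -> r0 ^+ n = f x0 ->
  lifts_to D f n x0 r0 x r -> lifts_to D f n x0 r0 x r' -> r = r'.
Proof.
move=> [_ sD] r0n [g [h [cg Dg ch hn [g0 h0 g1 h1]]]]
  [g' [h' [cg' Dg' ch' hn' [g'0 h'0 g'1 h'1]]]].
(* L runs along g for s <= 1/2, then along g' backwards. *)
pose L (s : R) := g (clamp (2 * s + 0)) + g' (clamp (-2 * s + 2)) - x.
have cL : continuous L by apply: continuous_junction; exact: continuous_clamp_affine.
have L1 s : s <= 1 / 2 -> L s = g (clamp (2 * s)).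
  by move=> s2; rewrite /L addr0 [clamp (-2 * s + 2)]clamp1 ?g'1 ?addrK//; lra.
have L2 s : 1 / 2 <= s -> L s = g' (clamp (2 - 2 * s)).
  move=> s2; rewrite /L [clamp (2 * s + 0)]clamp1 ?g1; last lra.
  by rewrite [x + _]addrC addrK; congr (g' (clamp _)); lra.
have DL s : D (L s) by have [/L1 ->//|/ltW/L2 ->//] := leP s (1 / 2).
have L0 : L 0 = x0 by rewrite L1 ?mulr0 ?clamp0//; lra.
have L01 : L 1 = x0 by rewrite L2 ?clamp0 //; lra.
have pL : path_in D L.
  by split; [exact: continuous_subspaceT|move=> s _; exact: DL].
have [H [cH DH Hs Ht]] := sD L pL (etrans L0 (esym L01)).
have cK : continuous (H \o (fun p : R * R => (clamp p.1, clamp p.2))).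
  apply: continuous_within_comp cH; last by move=> p; split; exact: clamp_itv.
  apply: continuous_pair => p.
    by apply: (@continuous_comp _ _ _ fst); [exact: cvg_fst|exact: continuous_clamp].
  by apply: (@continuous_comp _ _ _ snd); [exact: cvg_snd|exact: continuous_clamp].
have DK p : D (H (clamp p.1, clamp p.2)) by apply: DH; exact: clamp_itv.
have [k ck kn] := root_on_square n0 (continuous_along cK DK) (fun p => f0 (DK p)).
have r00 : r0 != 0.
  apply: contra_neq (f0 (Dg 0)) => r00.
  by rewrite g0 -r0n r00 expr0n gtn_eqF.
have i0 : (0 : R) \in `[0, 1] by rewrite in_itv /= lexx ler01.
have k0 : k (0, 0) ^+ n = r0 ^+ n.
  by rewrite kn//= !clamp0// (Hs 0 i0).1 L0.
have k00 : k (0, 0) != 0.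
  apply: contra_neq r00 => E; apply/eqP; move/esym/eqP: k0.
  by rewrite E expr0n gtn_eqF//= expf_eq0 => /andP[].
(* The root over the square, normalised to take the value r0 at the corner. *)
pose K s t := k (clamp s, clamp t) * (r0 / k (0, 0)).
have Kn s t : K s t ^+ n = f (H (clamp s, clamp t)).
  rewrite /K exprMn expr_div_n k0 divff ?expf_neq0// mulr1 kn ?clamp_itv//=.
  by rewrite !(clamp_id (clamp_itv _)).
have KE : K 0 0 = r0 by rewrite /K !clamp0// mulrC divfK.
have cKK (a b : R -> R) : continuous a -> continuous b ->
    continuous (fun s => K (a s) (b s)).
  move=> ca cb; apply: (continuous_mul _ (@continuous_const _ _ _)).
  apply: continuous_compose ck.
  exact: (continuous_pair (continuous_compose ca (@continuous_clamp R))
                          (continuous_compose cb (@continuous_clamp R))).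
have cid : continuous (fun s : R => s) by move=> ?.
have ccst (c : R) : continuous (fun _ : R => c) by move=> ?; exact: cvg_cst.
have caff (a b : R) : continuous (fun s : R => a * clamp s + b).
  exact: (continuous_add (continuous_mul (@continuous_const _ _ a) (@continuous_clamp R))
                (@continuous_const _ _ b)).
have r0neq (s : R) : r0 != 0 by [].
have crst : continuous (fun _ : R => r0) by move=> ?; exact: cvg_cst.
(* The value r0 propagates along the sides s = 0, t = 1 and s = 1. *)
have E01 : K 0 1 = r0.
  apply: (@root_unique R n (K 0) _ n0 (cKK _ _ (ccst 0) cid) crst _ r0neq KE 1) => s.
  by rewrite Kn clamp0// (Ht _ (clamp_itv s)).1 L0.
have E11 : K 1 1 = r0.
  apply: (@root_unique R n (K^~ 1) _ n0 (cKK _ _ cid (ccst 1)) crst _ r0neq E01 1) => s.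
  by rewrite Kn [clamp 1]clamp1// (Hs _ (clamp_itv s)).2 L0.
have E10 : K 1 0 = r0.
  have := @root_unique R n (fun t => K 1 (-1 * clamp t + 1)) _ n0
    (cKK _ _ (ccst 1) (caff (-1) 1)) crst _ r0neq _ 1.
  rewrite [clamp 1]clamp1// [clamp 0]clamp0// mulr0 add0r mulr1 addNr.
  by apply => // s; rewrite Kn [clamp 1]clamp1// (Ht _ (clamp_itv _)).2 L0.
have hneq s : h s != 0.
  by apply: contra_neq (f0 (Dg s)) => E; rewrite -hn E expr0n gtn_eqF.
have h'neq s : h' s != 0.
  by apply: contra_neq (f0 (Dg' s)) => E; rewrite -hn' E expr0n gtn_eqF.
have chc (u : R -> Cx R) : continuous u -> continuous (fun s => u (clamp s)).
  exact: continuous_compose (@continuous_clamp R).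
have cc s : clamp (clamp s) = clamp s :> R by rewrite clamp_id ?clamp_itv.
have Eh : K (1 / 2) 0 = r.
  have := @root_unique R n (fun s => K (1 / 2 * clamp s + 0) 0) _ n0
    (cKK _ _ (caff (1 / 2) 0) (ccst 0)) (chc _ ch) _ (fun s => hneq _) _ 1.
  rewrite /= [clamp 1]clamp1// [clamp 0]clamp0// mulr0 !addr0 mulr1 h1 KE h0.
  apply => // s; have [sI s2 sE _ _] := clamp_halves s.
  by rewrite Kn hn [clamp 0]clamp0// (Hs _ (clamp_itv _)).1 (clamp_id sI) L1//
    sE cc.
have Eh' : K (1 / 2) 0 = r'.
  have := @root_unique R n (fun s => K (- (1 / 2) * clamp s + 1) 0) _ n0
    (cKK _ _ (caff (- (1 / 2)) 1) (ccst 0)) (chc _ ch') _ (fun s => h'neq _) _ 1.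
  rewrite /= [clamp 1]clamp1// [clamp 0]clamp0// mulr0 !add0r mulr1 h'1 E10 h'0.
  rewrite half_compl.
  apply => // s; have [_ _ _ sI [s2 sE]] := clamp_halves s.
  by rewrite Kn hn' [clamp 0]clamp0// (Hs _ (clamp_itv _)).1 (clamp_id sI) L2//
    sE cc.
by rewrite -Eh -Eh'.
Qed.

(** Near [x1] the path is prolonged by a segment, along which the principal root of
    [f / f x1] continues the root; so the lifted value varies continuously with
    the endpoint. *)
Lemma lifts_to_near x0 r0 x1 r1 : open D -> D x1 -> lifts_to D f n x0 r0 x1 r1 ->
  \forall x \near x1, D x /\ lifts_to D f n x0 r0 x (r1 * principal_root n (f x / f x1)).
Proof.
move=> oD Dx1 [g [h [cg Dg ch hn [g0 h0 g1 h1]]]].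
have near1 : \forall x \near x1, D x /\ `|f x / f x1 - 1| < 1.
  apply: filterI; first exact: open_nbhs_nbhs.
  have cq : continuous_on D (fun x => f x / f x1).
    exact: (continuous_onM cf (@continuous_on_cst R D (f x1)^-1)).
  have b1 : nbhs (f x1 / f x1 : Cx R) [set w : Cx R | `|w - 1| < 1].
    rewrite divff ?f0//; have := near_dist_Cx (1 : Cx R) ltr01.
    by apply: filterS => w /=; rewrite distrC.
  exact: (cq x1 Dx1 _ b1).
have /nbhs_normP[e /= e0 be] := near1.
apply/nbhs_normP; exists e => //= x xe; split; first by have [] := be x xe.
pose seg (s : R) : Cx R := x1 + toCx (clamp s) * (x - x1).
have cseg : continuous seg.
  apply: (continuous_add (@continuous_const _ _ x1)).
  apply: (continuous_mul _ (@continuous_const _ _ _)).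
  exact: continuous_compose (@continuous_clamp R) (@continuous_toCx R).
have segb s : `|x1 - seg s| < e.
  rewrite /seg opprD addrA subrr sub0r normrN normrM.
  move: xe; rewrite distrC; apply: le_lt_trans.
  have := clamp_itv s; rewrite in_itv /= => /andP[c0 c1].
  rewrite ger0_norm ?lecR// ler_piMl// -[1]/(toCx 1) lecR//.
have Dseg s : D (seg s) by have [] := be _ (segb s).
have nseg s : `|f (seg s) / f x1 - 1| < 1 by have [] := be _ (segb s).
have seg0 s : s <= 0 -> seg s = x1 by move=> s0; rewrite /seg clamp0// mul0r addr0.
have seg1 : seg 1 = x by rewrite /seg clamp1// mul1r addrC subrK.
have s0 (s : R) : s <= 1 / 2 -> 2 * s - 1 <= 0 by lra.
have s1 (s : R) : 1 / 2 < s -> 1 <= 2 * s by lra.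
have t1 : 2 * 1 - 1 = 1 :> R by lra.
have fx1 : f x1 != 0 by exact: f0.
exists (fun s => g (clamp (2 * s + 0)) + seg (2 * s - 1) - x1).
exists (fun s => h (clamp (2 * s + 0)) * principal_root n (f (seg (2 * s - 1)) / f x1)).
have cs : continuous (fun s : R => seg (2 * s - 1)).
  apply: continuous_compose cseg; apply: (continuous_add _ (@continuous_const _ _ _)).
  by apply: (continuous_mul (@continuous_const _ _ _)) => ?.
have ratio1 s : s <= 0 -> principal_root n (f (seg s) / f x1) = 1.
  by move=> ss; rewrite seg0// divff// principal_root1.
split.
- by apply: continuous_junction cs; exact: continuous_clamp_affine.
- move=> s; have [/s0/seg0 ->|/s1 ss] := leP s (1 / 2); first by rewrite addrK.
  by rewrite addr0 [clamp _]clamp1// g1 addrC addKr.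
- apply: continuous_mul; first exact: continuous_clamp_affine.
  exact: (continuous_root_ratio (continuous_along cs (fun s => Dseg _))
    (@continuous_const R (Cx R) (f x1)) (fun _ => fx1) (fun s => nseg _)).
- move=> s; rewrite exprMn hn principal_rootX//; last by apply: Re_gt0_near1; exact: nseg.
  have [/s0/seg0 ->|/s1 ss] := leP s (1 / 2); first by rewrite addrK divff// mulr1.
  by rewrite addr0 [clamp _]clamp1// g1 [x1 + _]addrC addrK mulrC divfK.
- have g20 : g (clamp (2 * 0 + 0)) = x0 by rewrite mulr0 addr0 clamp0.
  have h20 : h (clamp (2 * 0 + 0)) = r0 by rewrite mulr0 addr0 clamp0.
  have g21 : g (clamp (2 * 1 + 0)) = x1 by rewrite mulr1 addr0 clamp1 ?ler1n.
  have h21 : h (clamp (2 * 1 + 0)) = r1 by rewrite mulr1 addr0 clamp1 ?ler1n.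
  have m1 : 2 * 0 - 1 <= 0 :> R by lra.
  by rewrite g20 h20 g21 h21 t1 ratio1// seg0// seg1 mulr1 addrK [x1 + x]addrC addrK.
Qed.

Lemma root_on_simply_connected : sc_domain D ->
  exists2 b : Cx R -> Cx R, continuous_on D b & forall x, D x -> b x ^+ n = f x.
Proof.
move=> [[x0 Dx0] oD _ scD]; pose r0 := n.-root (f x0).
have r0n : r0 ^+ n = f x0 by rewrite rootCK.
have /choice[b bP] : forall x, exists r, D x -> lifts_to D f n x0 r0 x r.
  move=> x; have [Dx|nDx] := pselect (D x); last by exists 0.
  by have [r ?] := lifts_to_ex scD.1 Dx0 r0n Dx; exists r.
exists b => x Dx; last first.
  by have [g [h [_ _ _ hn [_ _ <- <-]]]] := bP x Dx; exact: hn.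
have bnear : \forall y \near x, b y = b x * principal_root n (f y / f x).
  have := lifts_to_near oD Dx (bP x Dx); apply: filterS => y [Dy].
  exact: lifts_to_uniq scD r0n (bP y Dy).
have c1 : {for x, continuous (fun y => b x * principal_root n (f y / f x))}.
  apply: (@continuousM _ _ (cst (b x)) (fun y => principal_root n (f y / f x))).
    exact: cst_continuous.
  apply: (@continuous_comp _ _ _ (fun y => f y / f x)).
    exact: (continuous_onM cf (@continuous_on_cst R D (f x)^-1) Dx).
  by apply: continuous_principal_root; rewrite divff ?f0//= ltr01.
have bx : b x = b x * principal_root n (f x / f x).
  by rewrite divff ?f0// principal_root1 mulr1.
move=> B; rewrite bx => /c1 hB.
suff: nbhs x (b @^-1` B) by [].
by near=> y; rewrite /= (near bnear y)//; near: y; exact: hB.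
Unshelve. all: by end_near. Qed.

End Lift.

(** * The power map in split coordinates *)

Section Algebra.
Context {R : realType}.
Implicit Types (v : 'rV[Cx R]_3) (a : Cx R).

Lemma scal_row_mx a v : scal (row_mx a%:M v : C4 R) = a.
Proof.
have -> : scal (row_mx a%:M v : C4 R) = (row_mx a%:M v : C4 R) 0 (lshift 3 0).
  by rewrite /scal; congr (_ _ _); apply: val_inj.
by rewrite row_mxEl mxE eqxx mulr1n.
Qed.

Lemma vect_row_mx a v : vect (row_mx a%:M v : C4 R) = v.
Proof. exact: row_mxKr. Qed.

Lemma C4E (z : C4 R) : z = row_mx (scal z)%:M (vect z).
Proof.
rewrite -[LHS]hsubmxK; congr row_mx; apply/matrixP => i j.
rewrite !ord1 !mxE eqxx mulr1n /scal; congr (z _ _); exact: val_inj.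
Qed.

Lemma sqvZ a v : sqv (a *: v) = a ^+ 2 * sqv v.
Proof. by rewrite /sqv mulr_sumr; apply: eq_bigr => i _; rewrite mxE exprMn. Qed.

(** With [g0] and [c w] half the sum and half the difference (over [i]) of [p] and
    [q], these are [g0 + i c w] and [g0 - i c w].  The two expansions of [pow_partsE],
    for the square roots [i] and [- i] of [-1], then give the two components of
    [sigma k]. *)
Lemma sigma_root k (z : C4 R) (w p q : Cx R) :
  w ^+ 2 = sqv (vect z) -> w != 0 ->
  p ^+ k = scal z + 'i * w -> q ^+ k = scal z - 'i * w ->
  sigma k (row_mx ((p + q) / 2)%:M (((p - q) / (2 * 'i * w)) *: vect z)) = z.
Proof.
move=> w2 w0 pk qk; set g0 := (p + q) / 2; set c := (p - q) / _.
have i0 : 'i != 0 :> Cx R by exact: neq0Ci.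
have t0 : 2 != 0 :> Cx R by rewrite pnatr_eq0.
have i2 : 'i ^+ 2 = -1 :> Cx R by exact: sqrCi.
have pE : p = g0 + 'i * (c * w) by rewrite /g0 /c; field; rewrite i0 w0.
have qE : q = g0 + - 'i * (c * w) by rewrite /g0 /c; field; rewrite i0 w0.
rewrite /sigma scal_row_mx vect_row_mx sqvZ -w2 -exprMn.
have := pow_partsE k g0 (c * w) i2.
have := pow_partsE k g0 (c * w) (etrans (sqrrN _) i2).
rewrite -pE -qE pk qk; set P := eval2 _ _ _; set Q := eval2 _ _ _ => eq ep.
have EP : P = scal z.
  apply: (mulfI t0); transitivity ((scal z + 'i * w) + (scal z - 'i * w)); last by ring.
  by rewrite ep eq; ring.
have EQ : Q * c = 1.
  apply: (mulfI w0); apply: (mulfI i0); apply: (mulfI t0).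
  transitivity ((scal z + 'i * w) - (scal z - 'i * w)); last by ring.
  by rewrite ep eq; ring.
by rewrite EP scalerA EQ scale1r -C4E.
Qed.

(** The scalar product of the vector part with [vect z] recovers [(p - q) / (2 i)],
    and with it [p]: different roots give different functions. *)
Lemma root_of_sigma (z : C4 R) (w p q : Cx R) : w ^+ 2 = sqv (vect z) -> w != 0 ->
  let g : C4 R := row_mx ((p + q) / 2)%:M (((p - q) / (2 * 'i * w)) *: vect z) in
  p = scal g + 'i * ((\sum_i vect g 0 i * vect z 0 i) / w).
Proof.
move=> w2 w0 /=; rewrite scal_row_mx vect_row_mx.
have i0 : 'i != 0 :> Cx R by exact: neq0Ci.
have -> : \sum_i (((p - q) / (2 * 'i * w)) *: vect z) 0 i * vect z 0 i =
    (p - q) / (2 * 'i * w) * w ^+ 2.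
  by rewrite w2 /sqv mulr_sumr; apply: eq_bigr => i _; rewrite mxE -mulrA.
by field; rewrite i0 w0.
Qed.

End Algebra.

(** * Roots compatible with conjugation *)

Section AdmissibleDomains.
Context {R : realType}.

Lemma continuous_glue (D1 D2 : set (Cx R)) (u1 u2 : Cx R -> Cx R) :
  open D1 -> open D2 -> D1 `&` D2 = set0 -> continuous_on D1 u1 -> continuous_on D2 u2 ->
  exists2 u : Cx R -> Cx R, continuous_on (D1 `|` D2) u &
    (forall z, D1 z -> u z = u1 z) /\ (forall z, D2 z -> u z = u2 z).
Proof.
move=> o1 o2 d12 c1 c2; pose u z := if z \in D1 then u1 z else u2 z.
have e1 z : D1 z -> u z = u1 z by move=> /mem_set h; rewrite /u h.
have e2 z : D2 z -> u z = u2 z.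
  move=> h2; rewrite /u; case: ifPn => //; rewrite inE => h1.
  by have : (D1 `&` D2) z by []; rewrite d12.
exists u; last by [].
move=> x [|] Dx; first exact: (eq_continuous_on o1 e1 c1).
exact: (eq_continuous_on o2 e2 c2).
Qed.

Lemma admissible_open (U : set (Cx R)) : admissible U -> open U.
Proof. by case=> [[[]]//|[D1 [D2 [[_ ? _ _] [_ ? _ _] _ _ ->]]]]; exact: openU. Qed.

Lemma admissible_neq0 (U : set (Cx R)) : admissible U -> U !=set0.
Proof. by case=> [[[]]//|[D1 [D2 [[[x ?] _ _ _] _ _ _ ->]]]]; exists x; left. Qed.

Lemma conj_imageE (A B : set (Cx R)) z : Num.conj @` A = B -> B z <-> A z^*.
Proof.
move=> <-; split => [[x Ax <-]|Az]; first by rewrite conjCK.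
by exists z^* => //; rewrite conjCK.
Qed.

Lemma admissible_conj (U : set (Cx R)) z : admissible U -> U z -> U z^*.
Proof.
case=> [[_ E] Uz|[D1 [D2 [_ _ _ E ->]]] [h|h]].
- by apply/(conj_imageE _ E); rewrite conjCK.
- by right; apply/(conj_imageE _ E); rewrite conjCK.
- by left; apply/(conj_imageE _ E).
Qed.

Lemma admissible_root (U : set (Cx R)) n (f : Cx R -> Cx R) : (0 < n)%N ->
  admissible U -> continuous_on U f -> (forall z, U z -> f z != 0) ->
  exists2 b : Cx R -> Cx R, continuous_on U b & forall z, U z -> b z ^+ n = f z.
Proof.
move=> n0 [[scU _]|[D1 [D2 [sc1 sc2 d12 _ ->]]]] cf f0.
  exact: root_on_simply_connected.
have [b1 c1 h1] := root_on_simply_connected n0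
  (fun z Dz => cf z (or_introl Dz)) (fun z Dz => f0 z (or_introl Dz)) sc1.
have [b2 c2 h2] := root_on_simply_connected n0
  (fun z Dz => cf z (or_intror Dz)) (fun z Dz => f0 z (or_intror Dz)) sc2.
have [_ o1 _ _] := sc1; have [_ o2 _ _] := sc2.
have [b cb [e1 e2]] := continuous_glue o1 o2 d12 c1 c2.
by exists b => // z [Dz|Dz]; [rewrite e1// h1|rewrite e2// h2].
Qed.

(** The image of [D] under the imaginary part is an interval symmetric about [0]. *)
Lemma real_point (D : set (Cx R)) : sc_domain D -> Num.conj @` D = D ->
  exists2 z, D z & z^* = z.
Proof.
move=> [[x Dx] _ cD _] cE.
have : connected ((@complex.Im R : Cx R -> R) @` D).
  apply: connected_continuous_connected => //.
  by apply: continuous_subspaceT; exact: continuous_Im.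
move=> /connected_intervalP iI.
have Dxc : D x^* by apply/(conj_imageE _ cE); rewrite conjCK.
have ImC (z : Cx R) : complex.Im (z^*) = - complex.Im z by case: z.
have [z Dz Iz] : ((@complex.Im R : Cx R -> R) @` D) 0.
  have [h|h] := leP 0 (complex.Im x).
    apply: (iI (complex.Im x^*) (complex.Im x)); [by exists x^*|by exists x|].
    by rewrite ImC oppr_le0 h.
  apply: (iI (complex.Im x) (complex.Im x^*)); [by exists x|by exists x^*|].
  by rewrite ImC oppr_ge0 ltW.
by exists z => //; case: z Iz {Dz} => a b /= ->; congr Complex; rewrite oppr0.
Qed.

Lemma sqrt_pos_real (w : Cx R) : 0 < w ^+ 2 -> w^* = w.
Proof.
move=> w2; have : (w^* - w) * (w^* + w) == 0.
  rewrite mulrDr !mulrBl [w * _]mulrC addrA subrK subr_eq0 -!expr2 -rmorphXn.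
  by apply/eqP; apply: CrealP; rewrite realE ltW.
rewrite mulf_eq0 subr_eq0 addr_eq0 => /orP[/eqP//|/eqP E].
have : 0 <= w * w^* by exact: mul_conjC_ge0.
by rewrite E mulrN oppr_ge0 -expr2 (lt_geF w2).
Qed.

(** A square root chosen on a self-conjugate domain differs from its reflection by
    a sign that is constant by connectedness, and the positivity of [s] at a real
    point forces this sign to be [1].  On two conjugate domains the root is
    defined on the second one by reflection. *)
Lemma stem_sqrt (U : set (Cx R)) (s : Cx R -> Cx R) : admissible U ->
  continuous_on U s -> (forall z, U z -> s z != 0) ->
  (forall z, U z -> (s z^*)^* = s z) ->
  (forall z, U z -> z^* = z -> 0 < s z) ->
  exists w : Cx R -> Cx R, [/\ continuous_on U w, forall z, U z -> w z ^+ 2 = s z &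
    forall z, U z -> (w z^*)^* = w z].
Proof.
move=> aU cs s0 sT spos.
have Ucj z : U z -> U z^* by exact: admissible_conj.
case: (aU) => [[scU cU]|[D1 [D2 [sc1 sc2 d12 E12 UE]]]].
  have [w cw w2] := root_on_simply_connected (ltn0Sn 1) cs s0 scU.
  have w0 z : U z -> w z != 0 by move=> Uz; rewrite -sqrf_eq0 w2// s0.
  have [x0 Ux0 x0r] := real_point scU cU.
  have [_ oU conU _] := scU.
  exists w; split => // z Uz.
  have cq : {within U, continuous (fun z => (w z^*)^* / w z)}.
    apply: (continuous_onP _ oU).2.
    exact: (continuous_onM (continuous_on_conj Ucj cw) (continuous_onV w0 cw)).
  have q1 x : U x -> ((w x^*)^* / w x) ^+ 2 = 1.
    move=> Ux; have Uxc := Ucj x Ux.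
    by rewrite expr_div_n -rmorphXn /= !w2// sT// divff// s0.
  have := unity_valued_const (ltn0Sn 1) conU cq q1 Uz Ux0.
  rewrite x0r (@sqrt_pos_real (w x0)) ?w2 ?spos// divff ?w0//.
  by move=> /(congr1 ( *%R^~ (w z))); rewrite divfK ?w0// mul1r.
have D1U z : D1 z -> U z by rewrite UE; left.
have [w1 cw1 w12] := root_on_simply_connected (ltn0Sn 1)
  (fun z Dz => cs z (D1U z Dz)) (fun z Dz => s0 z (D1U z Dz)) sc1.
have [_ o1 _ _] := sc1; have [_ o2 _ _] := sc2.
have D21 z : D2 z -> D1 z^* by move/(conj_imageE _ E12).
have D12 z : D1 z -> D2 z^* by move=> Dz; apply/(conj_imageE _ E12); rewrite conjCK.
have [w cw [e1 e2]] := continuous_glue o1 o2 d12 cw1 (continuous_on_conj D21 cw1).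
exists w; rewrite UE; split; [exact: cw|move=> z [Dz|Dz]..].
- by rewrite e1// w12.
- rewrite e2// -rmorphXn w12; last exact: D21.
  by apply: sT; rewrite UE; right.
- by rewrite (e1 z Dz) (e2 _ (D12 z Dz)) !conjCK.
- by rewrite (e2 z Dz) (e1 _ (D21 z Dz)).
Qed.

End AdmissibleDomains.

Unset Implicit Arguments.

Theorem theorem6p9 (R : realType) (U : set (Cx R)) (hU : admissible U)
    (k : nat) (hk1 : (1 <= k)%N) (hkodd : odd k)
    (F : Cx R -> C4 R) (hFcont : {within U, continuous F})
    (hFOmega : F @` U `<=` @Omega R)
    (hFstem : forall z, U z -> Tconj F z = F z) :
  exists G : 'I_k -> Cx R -> C4 R,
    (forall i j : 'I_k, i != j -> exists2 z, U z & G i z <> G j z) /\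
    (forall i : 'I_k,
      [/\ {within U, continuous (G i)},
          (forall z, U z -> sigma k (G i z) = F z)
        & (forall z, U z -> Tconj (G i) z = G i z)]).
Proof.
have oU := admissible_open hU.
have Ucj z : U z -> U z^* by exact: admissible_conj.
have cF : continuous_on U F by exact: (continuous_onP F oU).1.
have FO z : U z -> Omega (F z) by move=> Uz; apply: hFOmega; exists z.
have Fcj z : U z -> F z^* = map_mx Num.conj (F z).
  by move=> Uz; rewrite -(hFstem _ (Ucj z Uz)) /Tconj conjCK.
pose s z := sqv (vect (F z)).
have scj z : U z -> s z^* = (s z)^*.
  move=> Uz; rewrite /s Fcj// /sqv rmorph_sum; apply: eq_bigr => i _.
  by rewrite rmorphXn /= !mxE.
have sclcj z : U z -> scal (F z^*) = (scal (F z))^*.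
  by move=> Uz; rewrite Fcj// /scal mxE.
have vcj z : U z -> map_mx Num.conj (vect (F z^*)) = vect (F z).
  by move=> Uz; rewrite Fcj//; apply/matrixP => i j; rewrite !mxE conjCK.
have cv i : continuous_on U (fun z => vect (F z) 0 i).
  have -> : (fun z => vect (F z) 0 i) = (fun z => F z 0 (rshift 1 i)).
    by apply/funext => z; rewrite mxE.
  exact: continuous_on_entry.
have cs : continuous_on U s.
  by apply: continuous_on_sum => i; exact: (continuous_onM (cv i) (cv i)).
have s0 z : U z -> s z != 0 by move=> /FO[].
(* At a real point F equals its own conjugate, so s is a sum of squares of reals. *)
have spos z : U z -> z^* = z -> 0 < s z.
  move=> Uz zr; rewrite lt_def s0//=; apply: sumr_ge0 => i _.
  rewrite real_exprn_even_ge0//; apply/CrealP.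
  by rewrite !mxE -{2}zr Fcj// mxE.
have sT z : U z -> (s z^*)^* = s z by move=> Uz; rewrite scj// conjCK.
have [w [cw w2 wT]] := stem_sqrt hU cs s0 sT spos.
have w0 z : U z -> w z != 0 by move=> Uz; rewrite -sqrf_eq0 w2// s0.
pose a z := scal (F z) + 'i * w z.
have ca : continuous_on U a.
  apply: continuous_onD; first exact: continuous_on_entry.
  exact: (continuous_onM (@continuous_on_cst _ _ 'i) cw).
have a0 z : U z -> a z != 0.
  move=> Uz; have [_ + _] := FO z Uz; apply: contra_neq => az0.
  have i2 : 'i ^+ 2 = -1 :> Cx R by exact: sqrCi.
  have -> : scal (F z) ^+ 2 + sqv (vect (F z)) = (scal (F z) - 'i * w z) * a z.
    by rewrite -[sqv _]w2// /a -subr_sqr exprMn i2 mulN1r opprK.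
  by rewrite az0 mulr0.
have acj z : U z -> (a z^*)^* = scal (F z) - 'i * w z.
  by move=> Uz; rewrite rmorphD rmorphM /= conjCi sclcj// conjCK wT// mulNr.
have [b cb bk] := admissible_root hk1 hU ca a0.
have [om [omu oms omE]] := @roots_of_unity R k hk1.
pose p (i : 'I_k) z := om`_i * b z.
pose q (i : 'I_k) z := (p i z^*)^*.
have cp i : continuous_on U (p i)
  by exact: (continuous_onM (@continuous_on_cst _ _ _) cb).
have cq i : continuous_on U (q i) by exact: continuous_on_conj (cp i).
have omk (i : 'I_k) : om`_i ^+ k = 1.
  by apply/eqP; rewrite -omE mem_nth// oms.
have pk i z : U z -> p i z ^+ k = a z by move=> Uz; rewrite exprMn omk mul1r bk.
have qk i z : U z -> q i z ^+ k = scal (F z) - 'i * w z.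
  by move=> Uz; rewrite -rmorphXn /= (pk i _ (Ucj z Uz)) acj.
pose G i z : C4 R := row_mx ((p i z + q i z) / 2)%:M
  (((p i z - q i z) / (2 * 'i * w z)) *: vect (F z)).
have i0 : 'i != 0 :> Cx R by exact: neq0Ci.
have t0 : 2 != 0 :> Cx R by rewrite pnatr_eq0.
exists G; split=> [i j ij|i].
  have [z Uz] := admissible_neq0 hU; exists z => // GE.
  have := root_of_sigma (p i z) (q i z) (w2 z Uz) (w0 z Uz).
  rewrite /= -/(G i z) GE /G -(root_of_sigma _ _ (w2 z Uz) (w0 z Uz)).
  have bz : b z != 0.
    by apply: contra_neq (a0 z Uz) => bz; rewrite -bk// bz expr0n gtn_eqF.
  move=> /(mulIf bz)/eqP; rewrite nth_uniq ?oms// => /eqP/val_inj/eqP.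
  by rewrite (negbTE ij).
split.
- apply: (continuous_onP _ oU).2; apply: continuous_on_mx => r j.
  rewrite ord1; have [j' ->|j' ->] := split_ordP j.
    have -> : (fun z => G i z 0 (lshift 3 j')) = (fun z => (p i z + q i z) / 2).
      by apply/funext => z; rewrite row_mxEl mxE (ord1 j') eqxx mulr1n.
    exact: (continuous_onM (continuous_onD (cp i) (cq i)) (@continuous_on_cst R U 2^-1)).
  have -> : (fun z => G i z 0 (rshift 1 j')) =
      (fun z => (p i z - q i z) / (2 * 'i * w z) * vect (F z) 0 j').
    by apply/funext => z; rewrite row_mxEr mxE.
  have c2iw := continuous_onM (@continuous_on_cst R U (2 * 'i)) cw.
  have n2iw z : U z -> 2 * 'i * w z != 0 by move=> Uz; rewrite !mulf_neq0// w0.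
  have cpq := continuous_onD (cp i) (continuous_onN (cq i)).
  exact: (continuous_onM (continuous_onM cpq (continuous_onV n2iw c2iw)) (cv j')).
- by move=> z Uz; apply: sigma_root; [exact: w2|exact: w0|exact: pk|exact: qk].
- move=> z Uz; rewrite /Tconj /G map_row_mx map_scalar_mx map_mxZ vcj//.
  have pq : (q i z^*)^* = p i z by rewrite /q !conjCK.
  have c2 : 2^* = 2 :> Cx R by exact: conjC_nat.
  have E1 : ((p i z^* + q i z^*) / 2)^* = (p i z + q i z) / 2.
    by rewrite fmorph_div rmorphD /= pq c2 addrC.
  have E2 : ((p i z^* - q i z^*) / (2 * 'i * w z^*))^* =
      (p i z - q i z) / (2 * 'i * w z).
    rewrite fmorph_div 2!rmorphM rmorphB /= pq c2 conjCi wT// -/(q i z).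
    by field; rewrite i0 w0.
  by congr (row_mx _%:M (_ *: _)); [exact: E1|exact: E2].
Qed.
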